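(* Let $R\ge 1$, let $0<b_1<b_2<\cdots<b_R$ be positive integers, and let $A_{\nu_1},\dots,A_{\nu_R}$ be independent Poisson random variables with means $\nu_1,\dots,\nu_R>0$. Put $S=\sum_{r=1}^R b_rA_{\nu_r}$, $\mu=E[S]=\sum_{r=1}^R b_r\nu_r$, $\sigma^2=\mathrm{Var}(S)=\sum_{r=1}^R b_r^2\nu_r$, $\beta=\mu/\sigma^2$ (an arbitrary real number, possibly irrational), $\lambda=\beta\mu$ and $\delta_r=b_r\nu_r/\mu$ for $r=1,\dots,R$. Assume $\lambda\ge 1$. Then for all integers $y>\lambda+1$, $$\left|\frac{P(\beta S\ge y)}{P(A_\lambda\ge y)}-1\right|\le (1+\alpha^* )\,\mathfrak{C}_+(y;\lambda)+(1+\alpha^* )\,\mathfrak{C}_-(y;\lambda)+\alpha^*,$$ where $$\mathfrak{C}_+(y;\lambda)=\frac{\lambda+1}{y\,\pi_{y-1}},\qquad \mathfrak{C}_-(y;\lambda)=\frac{2\lambda}{\min\{\pi_0,\lfloor\lambda\rfloor\pi_{y-1}\}},$$ and $$\alpha^*=\sum_{r=r^*+1}^R(\lceil\beta b_r\rceil-2)\,\delta_r,\qquad r^*=\max\{r\in\{1,\dots,R\}:\beta b_r\le 1\}.$$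
   Context: $A_\lambda$ denotes a Poisson random variable with mean $\lambda$, and $\pi_k=P(A_\lambda=k)=e^{-\lambda}\lambda^k/k!$ for $k=0,1,2,\dots$. *)

(* Defs.v *)
From HB Require Import structures.
From mathcomp Require Import all_boot all_order all_algebra.
From mathcomp Require Import all_classical all_reals all_analysis.

Set Implicit Arguments.
Unset Strict Implicit.
Unset Printing Implicit Defensive.

Import Order.TTheory GRing.Theory Num.Theory.

Local Open Scope classical_set_scope.
Local Open Scope ring_scope.

(* [poisson_pmf nu k] is nu ^+ k / k! * expR (- nu) for nu > 0 only; it has the
   junk value 1 otherwise. *)
Definition poisson_rv d (T : measurableType d) (R : realType)
    (P : probability T R) (X : {RV P >-> nat}) (nu : R) : Prop :=
  forall k : nat, P (X @^-1` [set k]) = (poisson_pmf nu k)%:E.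

Definition mutually_independent d d' (T : measurableType d)
    (T' : measurableType d') (R : realType) (P : probability T R)
    (I : finType) (X : I -> {RV P >-> T'}) : Prop :=
  forall (J : {set I}) (B : I -> set T'),
    (forall i, measurable (B i)) ->
    P (\bigcap_(i in [set` J]) (X i @^-1` B i)) =
    (\prod_(i in J) P (X i @^-1` B i))%E.

Section CompoundPoissonBound.
Context {R : realType}.

Definition C_plus (y : nat) (lam : R) : R :=
  (lam + 1) / (y%:R * poisson_pmf lam y.-1).

Definition C_minus (y : nat) (lam : R) : R :=
  2 * lam / Num.min (poisson_pmf lam 0)
                    ((Num.floor lam)%:~R * poisson_pmf lam y.-1).

(* Families indexed by 1, ..., n are functions on 'I_n, the ordinal r standing
   for the index r.+1; [r_star] is an index in the range 1, ..., n. The set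
   whose maximum is taken is nonempty as soon as beta is the ratio of
   \sum_r b_r nu_r to \sum_r b_r^2 nu_r with b increasing, n >= 1 and b, nu
   positive, because then beta * b_1 <= 1. *)
Definition r_star n (b : 'I_n -> nat) (beta : R) : nat :=
  (\max_(r < n | (beta * (b r)%:R <= 1)%R) r.+1)%N.

Definition alpha_star n (b : 'I_n -> nat) (beta : R) (delta : 'I_n -> R) : R :=
  \sum_(r < n | (r_star b beta < r.+1)%N)
    (Num.ceil (beta * (b r)%:R) - 2)%:~R * delta r.

End CompoundPoissonBound.

(* Main.v *)
(* The right-hand side is so large that Markov's inequality suffices. On the one
   hand E[beta S] = beta mu = lam, so P(beta S >= y) <= lam / y; on the other
   hand P(A_lam >= y) >= pi_y = (lam / y) pi_(y-1). Hence the ratio lies in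
   [0, 1 / pi_(y-1)], and its distance to 1 is at most 1 / pi_(y-1), which is
   already at most C_-(y; lam) because floor lam <= lam; all the other terms are
   nonnegative. The moments of S come from the Stein identity
   E[X f(X)] = nu E[f(X + 1)] of a Poisson variable of mean nu. *)
Require Import Defs.
From HB Require Import structures.
From mathcomp Require Import all_boot all_order all_algebra.
From mathcomp Require Import all_classical all_reals all_analysis.
From mathcomp Require Import measurable_realfun ring lra.

Set Implicit Arguments.
Unset Strict Implicit.
Unset Printing Implicit Defensive.

Import Order.TTheory GRing.Theory Num.Theory.

Local Open Scope classical_set_scope.
Local Open Scope ring_scope.

(** Turns a finite second moment into the [Lfun] membership under which the variance is E[f^2] -
    E[f]^2. *)
Lemma Lfun2_sqr_lty d (T : measurableType d) (R : realType)
    (mu : {measure set T -> \bar R}) (f : T -> R) :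
  measurable_fun [set: T] f -> (\int[mu]_x (f x ^+ 2)%:E < +oo)%E ->
  f \in Lfun mu 2%:E.
Proof.
move=> mf foo; rewrite inE; apply/andP; split; rewrite inE//=.
rewrite /finite_norm unlock; apply: poweR_lty.
rewrite (eq_integral (fun x => (f x ^+ 2)%:E))// => x _ /=.
by rewrite powR_mulrn// real_normK// num_real.
Qed.

(** * Integration along random variables with values in the naturals *)

Section NatValued.
Local Open Scope ereal_scope.
Context d (T : measurableType d) (R : realType) (P : probability T R).

Lemma measurable_RV_nat (X : {RV P >-> nat}) (B : set nat) :
  measurable (X @^-1` B).
Proof. exact: measurable_funPTI. Qed.

Lemma measurable_fun_RV_nat d' (T' : measurableType d') (X : {RV P >-> nat})
  (f : nat -> T') D : measurable_fun D (f \o X).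
Proof.
move=> mD B mB; rewrite comp_preimage; apply: measurableI => //.
exact: measurable_RV_nat.
Qed.

(** The fibres of [X] cut [D] into countably many disjoint measurable pieces. Here [g] need not
    factor through [X], which the product formula for independent variables relies on. *)
Lemma ge0_integral_fibers (X : {RV P >-> nat}) (D : set T) (g : T -> \bar R) :
  measurable D -> measurable_fun D g -> (forall x, 0 <= g x) ->
  \int[P]_(x in D) g x =
    \sum_(k <oo) \int[P]_(x in D `&` X @^-1` [set k]) g x.
Proof.
move=> mD mg g0.
have UD : D = \bigcup_k (D `&` X @^-1` [set k]).
  by apply/seteqP; split => [x Dx|x [k _ []]//]; exists (X x).
rewrite [in LHS]UD ge0_integral_bigcup//.
- by move=> k; apply: measurableI => //; exact: measurable_RV_nat.
- by rewrite -UD.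
- by move=> i j _ _ [x [[_ /= <-] [_ /= <-]]].
Qed.

Lemma ge0_integral_comp_nat (X : {RV P >-> nat}) (D : set T) (f : nat -> R) :
  measurable D -> (forall k, 0 <= f k)%R ->
  \int[P]_(x in D) (f (X x))%:E =
    \sum_(k <oo) (f k)%:E * P (D `&` X @^-1` [set k]).
Proof.
move=> mD f0; rewrite (ge0_integral_fibers X)//; last first.
- by move=> x; rewrite lee_fin.
- exact: (measurable_fun_RV_nat X (fun k => (f k)%:E)).
apply: eq_eseriesr => k _.
rewrite (eq_integral (cst (f k)%:E)); last first.
  by move=> x; rewrite inE => -[_ /= ->].
by rewrite integral_cst//; apply: measurableI => //; exact: measurable_RV_nat.
Qed.

Lemma ge0_expectation_comp_nat (X : {RV P >-> nat}) (f : nat -> R) :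
  (forall k, 0 <= f k)%R ->
  'E_P[f \o X] = \sum_(k <oo) (f k)%:E * P (X @^-1` [set k]).
Proof.
move=> f0; rewrite unlock ge0_integral_comp_nat//.
by apply: eq_eseriesr => k _; rewrite setTI.
Qed.

(** On each fibre of [X] the factor [f \o X] is constant; expanding the other factor over the fibres
    of [Y] leaves joint point masses, which split by hypothesis. Finiteness of the second
    expectation lets it leave the series as a real scalar. *)
Lemma ge0_expectationM_indep (X Y : {RV P >-> nat}) (f g : nat -> R) :
  (forall k, 0 <= f k)%R -> (forall k, 0 <= g k)%R ->
  (forall j k, P (X @^-1` [set j] `&` Y @^-1` [set k]) =
     P (X @^-1` [set j]) * P (Y @^-1` [set k])) ->
  'E_P[g \o Y] \is a fin_num ->
  'E_P[(f \o X) \* (g \o Y)] = 'E_P[f \o X] * 'E_P[g \o Y].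
Proof.
move=> f0 g0 XY gfin; have mX k := measurable_RV_nat X [set k].
transitivity (\int[P]_x (f (X x) * g (Y x))%:E); first by rewrite unlock.
rewrite (ge0_integral_fibers X)//; last first.
- by move=> x; rewrite lee_fin mulr_ge0.
- apply/measurable_EFinP/measurable_funM => //.
    exact: (measurable_fun_RV_nat X f).
  exact: (measurable_fun_RV_nat Y g).
rewrite (ge0_expectation_comp_nat X f0) muleC -(fineK gfin) -nneseriesZl//.
  apply: eq_eseriesr => j _; rewrite (fineK gfin) setTI.
  rewrite (eq_integral (fun x => (f j)%:E * (g (Y x))%:E)); last first.
    by move=> x; rewrite inE /= => ->; rewrite EFinM.
  rewrite ge0_integralZl_EFin//; last 2 first.
  - by move=> x _; rewrite lee_fin.
  - exact/measurable_EFinP/(measurable_fun_RV_nat Y g).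
  rewrite ge0_integral_comp_nat// muleCA; congr *%E.
  rewrite (ge0_expectation_comp_nat Y g0) muleC.
  rewrite -(fineK (fin_num_measure P _ (mX j))) -nneseriesZl//.
    apply: eq_eseriesr => k _.
    by rewrite XY (fineK (fin_num_measure P _ (mX j))) muleCA.
  by move=> k _; rewrite mule_ge0// lee_fin.
by move=> k _; rewrite mule_ge0// lee_fin.
Qed.

End NatValued.

(** * Moments of a Poisson variable *)

Section PoissonMoments.
Context {R : realType}.

Lemma poisson_pmf_gt0 (nu : R) k : 0 < poisson_pmf nu k.
Proof.
rewrite /poisson_pmf; case: ifPn => // nu0.
by rewrite !mulr_gt0 ?exprn_gt0 ?invr_gt0 ?ltr0n ?fact_gt0 ?expR_gt0.
Qed.

Lemma poisson_pmfS (nu : R) k : 0 < nu ->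
  k.+1%:R * poisson_pmf nu k.+1 = nu * poisson_pmf nu k.
Proof.
move=> nu0; rewrite /poisson_pmf nu0 factS natrM exprS; field.
by rewrite nat1r !pnatr_eq0 -lt0n fact_gt0.
Qed.

Section RV.
Context d (T : measurableType d) (P : probability T R).
Local Open Scope ereal_scope.

(** The term k = 0 of the series for E[X f(X)] vanishes; after a shift of the index, [poisson_pmfS]
    trades the factor k + 1 for [nu]. *)
Lemma poisson_rv_stein (X : {RV P >-> nat}) (nu : R) (f : nat -> R) :
  (0 < nu)%R -> poisson_rv X nu -> (forall k, 0 <= f k)%R ->
  'E_P[fun w => ((X w)%:R * f (X w))%R] = nu%:E * 'E_P[fun w => f (X w).+1].
Proof.
move=> nu0 Xnu f0.
rewrite (@ge0_expectation_comp_nat _ _ _ _ X (fun k => (k%:R * f k)%R));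
  last first.
  by move=> k; rewrite mulr_ge0.
rewrite (@ge0_expectation_comp_nat _ _ _ _ X (fun k => f k.+1))//.
rewrite nneseries_recl//; last first.
  by move=> k _; rewrite mule_ge0// lee_fin mulr_ge0.
rewrite mul0r mul0e add0e -nneseries_addn; last first.
  by move=> k; rewrite mule_ge0// lee_fin mulr_ge0.
rewrite -nneseriesZl; last by move=> k _; rewrite mule_ge0// lee_fin.
apply: eq_eseriesr => k _; rewrite addn1 !Xnu -!EFinM mulrAC poisson_pmfS//.
by rewrite mulrA mulrAC.
Qed.

Lemma poisson_rv_expectation (X : {RV P >-> nat}) (nu : R) :
  (0 < nu)%R -> poisson_rv X nu -> 'E_P[fun w => (X w)%:R] = nu%:E.
Proof.
move=> nu0 Xnu; transitivity (nu%:E * 'E_P[cst 1%R]).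
  rewrite -(poisson_rv_stein nu0 Xnu (f := cst 1%R))//.
  by congr expectation; apply/funext => w; rewrite /= mulr1.
by rewrite expectation_cst mule1.
Qed.

Lemma poisson_rv_expectation_sqr (X : {RV P >-> nat}) (nu : R) :
  (0 < nu)%R -> poisson_rv X nu ->
  'E_P[fun w => ((X w)%:R ^+ 2)%R] = (nu ^+ 2 + nu)%:E.
Proof.
(* The Stein identity with f(k) = k reduces the second moment to E[X + 1]. *)
move=> nu0 Xnu; transitivity (nu%:E * 'E_P[fun w => (X w).+1%:R%R]).
  by rewrite -(poisson_rv_stein nu0 Xnu (f := fun k => k%:R%R)).
have -> : 'E_P[fun w => (X w).+1%:R%R] =
    'E_P[fun w => (X w)%:R%R] + 'E_P[cst 1%R].
  rewrite !unlock -ge0_integralD//; last 2 first.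
  - exact: (measurable_fun_RV_nat X (fun k => (k%:R)%:E)).
  - exact/measurable_EFinP.
  by apply: eq_integral => w _; rewrite -EFinD /= -natr1.
rewrite (poisson_rv_expectation nu0 Xnu) expectation_cst -EFinD -EFinM.
by rewrite mulrDr mulr1.
Qed.

End RV.
End PoissonMoments.

(** * Mean and variance of the weighted sum [S] *)

Section CompoundPoissonMoments.
Context d (T : measurableType d) (R : realType) (P : probability T R) (n : nat).
Variables (b : 'I_n -> nat) (nu : 'I_n -> R) (A : 'I_n -> {RV P >-> nat}).
Hypothesis nu_gt0 : forall r, 0 < nu r.
Hypothesis A_poisson : forall r, poisson_rv (A r) (nu r).
Hypothesis A_indep : mutually_independent A.
Local Notation S := (fun w => \sum_(r < n) (b r)%:R * (A r w)%:R : R).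
Local Notation mu := (\sum_(r < n) (b r)%:R * nu r).
Local Notation sigma2 := (\sum_(r < n) (b r)%:R ^+ 2 * nu r).

Lemma measurable_compound_poisson : measurable_fun [set: T] S.
Proof.
apply: measurable_sum => r; apply: measurable_funM => //.
exact: (measurable_fun_RV_nat (A r) (fun k => k%:R : R)).
Qed.

Lemma compound_poisson_expectation : ('E_P[S] = mu%:E)%E.
Proof.
rewrite unlock (eq_integral
    (fun w => \sum_(r < n) (b r)%:R%:E * (A r w)%:R%:E)%E); last first.
  by move=> w _; rewrite -sumEFin; apply: eq_bigr => r _; rewrite EFinM.
rewrite ge0_integral_sum//; last first.
  move=> r; exact: (measurable_fun_RV_nat (A r)
    (fun k => (b r)%:R%:E * k%:R%:E)%E).
rewrite -sumEFin; apply: eq_bigr => r _; rewrite ge0_integralZl_EFin//.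
- have := poisson_rv_expectation (nu_gt0 r) (A_poisson r).
  by rewrite unlock EFinM => ->.
- exact: (measurable_fun_RV_nat (A r) (fun k => k%:R%:E)).
Qed.

Lemma independent_poisson_mixed_moment r s :
  ('E_P[(fun w => (A r w)%:R * (A s w)%:R)%R] =
     (nu r * nu s + (r == s)%:R * nu r)%:E)%E.
Proof.
have [<-{s}|rs] := eqVneq r s.
  have := poisson_rv_expectation_sqr (nu_gt0 r) (A_poisson r).
  by rewrite mul1r expr2.
have ind j k : (P (A r @^-1` [set j] `&` A s @^-1` [set k]) =
    P (A r @^-1` [set j]) * P (A s @^-1` [set k]))%E.
  (* Independence is applied to the index set {r, s}, so only the values of [B] at [r] and [s]
     count. *)
  pose B i : set nat := if i == r then [set j] else [set k].
  have mB i : measurable (B i) by [].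
  have := @A_indep [set r; s]%SET B mB; rewrite /B.
  rewrite big_setU1 ?inE//= big_set1 eqxx eq_sym (negbTE rs) => <-//.
  congr (P _); apply/seteqP; split => [w [/= wj wk] i /=|w /= wrs].
    by rewrite !inE => /orP[]/eqP ->; rewrite ?eqxx// eq_sym (negbTE rs).
  split.
    by have := wrs r; rewrite /= !inE eqxx; apply.
  by have := wrs s; rewrite /= !inE eqxx orbT eq_sym (negbTE rs); apply.
have Es := poisson_rv_expectation (nu_gt0 s) (A_poisson s).
have Er := poisson_rv_expectation (nu_gt0 r) (A_poisson r).
have := @ge0_expectationM_indep _ _ _ P (A r) (A s)
  (fun k => k%:R) (fun k => k%:R).
rewrite /comp /= Es Er => -> //.
by rewrite mul0r addr0 EFinM.
Qed.

(** The square is expanded over pairs of indices: the products of means sum to mu^2, and the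
    diagonal corrections to [sigma2]. *)
Lemma compound_poisson_expectation_sqr :
  ('E_P[(fun w => S w ^+ 2)%R] = (mu ^+ 2 + sigma2)%:E)%E.
Proof.
rewrite unlock (eq_integral (fun w => \sum_(p : 'I_n * 'I_n)
    ((b p.1)%:R * (b p.2)%:R)%:E *
    ((A p.1 w)%:R * (A p.2 w)%:R)%:E)%E); last first.
  move=> w _; rewrite expr2 big_distrlr /= pair_big /= -sumEFin.
  by apply: eq_bigr => p _; rewrite -EFinM mulrACA.
have mAA (p : 'I_n * 'I_n) :
    measurable_fun [set: T] (fun w => (A p.1 w)%:R * (A p.2 w)%:R : R).
  apply: measurable_funM.
    exact: (measurable_fun_RV_nat (A p.1) (fun k => k%:R : R)).
  exact: (measurable_fun_RV_nat (A p.2) (fun k => k%:R : R)).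
rewrite ge0_integral_sum//; last first.
  by move=> p; apply/measurable_funeM/measurable_EFinP.
rewrite (eq_bigr (fun p : 'I_n * 'I_n => ((b p.1)%:R * (b p.2)%:R *
    (nu p.1 * nu p.2 + (p.1 == p.2)%:R * nu p.1))%:E)); last first.
  move=> p _; rewrite ge0_integralZl_EFin//.
  - have := independent_poisson_mixed_moment p.1 p.2.
    by rewrite unlock => ->; rewrite -EFinM.
  - exact/measurable_EFinP.
rewrite sumEFin; congr EFin; under eq_bigr do rewrite mulrDr.
rewrite big_split /= expr2 big_distrlr /= pair_big /=; congr +%R.
  by apply: eq_bigr => p _; rewrite mulrACA.
rewrite -(pair_big xpredT xpredT
  (fun r s => (b r)%:R * (b s)%:R * ((r == s)%:R * nu r)))/=.
apply: eq_bigr => r _; rewrite (bigD1 r)//= eqxx mul1r big1 ?addr0//.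
by move=> s sr; rewrite eq_sym (negbTE sr) mul0r mulr0.
Qed.

Lemma compound_poisson_variance : ('V_P[S] = sigma2%:E)%E.
Proof.
rewrite varianceE.
  have -> : (S ^+ 2)%R = (fun w => S w ^+ 2) by [].
  rewrite compound_poisson_expectation_sqr compound_poisson_expectation.
  by rewrite -EFin_expe -EFinB addrAC subrr add0r.
apply: Lfun2_sqr_lty; first exact: measurable_compound_poisson.
by have := compound_poisson_expectation_sqr; rewrite unlock => ->; rewrite ltry.
Qed.

End CompoundPoissonMoments.

(** * Signs and sizes of the error terms *)

Lemma alpha_star_ge0 (R : realType) n (b : 'I_n -> nat) (beta : R)
    (delta : 'I_n -> R) :
  (forall r, 0 <= delta r) -> 0 <= alpha_star b beta delta.
Proof.
move=> delta0; apply: sumr_ge0 => r rs; apply: mulr_ge0 => //.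
(* [r_star] dominates every index with beta * b_r <= 1, so an index beyond it violates that
   inequality. *)
have br1 : 1 < beta * (b r)%:R.
  rewrite ltNge; apply: contraTN rs => br1; rewrite -leqNgt /r_star.
  exact: (@leq_bigmax_cond _ (fun r => beta * (b r)%:R <= 1)
    (fun r : 'I_n => r.+1)).
(* For an integer ceiling, being at least 2 means exceeding 1, which is [br1]. *)
rewrite ler0z subr_ge0 -[2%R]/(1 + 1)%R lezD1.
by rewrite real_ceil_gt_int ?num_real.
Qed.

Lemma C_plus_ge0 (R : realType) y (lam : R) : 0 <= lam -> 0 <= C_plus y lam.
Proof.
by move=> lam0; rewrite divr_ge0 ?addr_ge0// mulr_ge0// poisson_pmf_ge0.
Qed.

Lemma invr_poisson_pmf_le_C_minus (R : realType) y (lam : R) : 1 <= lam ->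
  (poisson_pmf lam y.-1)^-1 <= C_minus y lam.
Proof.
move=> lam1; have pi0 := poisson_pmf_gt0 lam.
(* Here [lam1] enters: with a positive floor the denominator of [C_minus] is positive, so the
   division is genuine. *)
have fl0 : 0 < (Num.floor lam)%:~R :> R.
  by rewrite ltr0z floor_gt0.
have m0 : 0 < Num.min (poisson_pmf lam 0)
    ((Num.floor lam)%:~R * poisson_pmf lam y.-1).
  by rewrite lt_min pi0 mulr_gt0.
rewrite /C_minus ler_pdivlMr// mulrC ler_pdivrMr//.
apply: (le_trans (y := (Num.floor lam)%:~R * poisson_pmf lam y.-1)).
  by rewrite ge_min lexx orbT.
rewrite ler_wpM2r ?poisson_pmf_ge0//.
have := real_floor_le (num_real lam); lra.
Qed.

(** * Tail bounds: Poisson from below, Markov from above *)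

Lemma poisson_rv_tail_lb d (T : measurableType d) (R : realType)
    (Q : probability T R) (X : {RV Q >-> nat}) (lam : R) (y : nat) :
  0 < lam -> (0 < y)%N -> poisson_rv X lam ->
  lam / y%:R * poisson_pmf lam y.-1 <= fine (Q [set w | (y <= X w)%N]).
Proof.
move=> lam0 y0 Xlam; have y0R : 0 < y%:R :> R by rewrite ltr0n.
(* The recurrence is used at [y.-1], whose successor is [y] because [y] is positive. *)
have -> : lam / y%:R * poisson_pmf lam y.-1 = poisson_pmf lam y.
  rewrite mulrAC -poisson_pmfS// prednK// mulrAC mulfV ?mul1r// gt_eqF//.
have mQ : measurable [set w | (y <= X w)%N].
  exact: (measurable_RV_nat X [set k | (y <= k)%N]).
rewrite -lee_fin fineK ?fin_num_measure// -Xlam le_measure ?inE//.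
  exact: measurable_RV_nat.
by move=> w /= ->.
Qed.

Lemma ge0_markov d (T : measurableType d) (R : realType)
    (P : probability T R) (f : T -> R) (a : R) :
  measurable_fun [set: T] f -> (forall w, 0 <= f w) -> 0 < a ->
  (a%:E * P [set w | a <= f w]%R <= 'E_P[f])%E.
Proof.
move=> mf f0 a0.
pose X : {RV P >-> R} := HB.pack f (isMeasurableFun.Build _ _ _ _ f mf).
have := @markov _ _ _ P X idfun a a0.
have -> : idfun \o (fun x => `|x|) \o X = f.
  by apply/funext => w /=; rewrite ger0_norm.
have -> : [set x | (a%:E <= `|(X x)%:E|)%E] = [set w | a <= f w].
  by apply/funext => w /=; rewrite lee_fin ger0_norm.
by apply=> //; exact: measurable_id.
Qed.

(** * Comparison of the two tails *)

Theorem corollary1 (R : realType) (d : measure_display) (T : measurableType d)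
    (P : probability T R) (n : nat) (b : 'I_n -> nat) (nu : 'I_n -> R)
    (A : 'I_n -> {RV P >-> nat})
    (n_ge1 : (1 <= n)%N)
    (b_gt0 : forall r, (0 < b r)%N)
    (b_incr : forall r s : 'I_n, (r < s)%N -> (b r < b s)%N)
    (nu_gt0 : forall r, 0 < nu r)
    (A_poisson : forall r, poisson_rv (A r) (nu r))
    (A_indep : mutually_independent A) :
  let S : T -> R := fun w => \sum_(r < n) (b r)%:R * (A r w)%:R in
  let mu : R := \sum_(r < n) (b r)%:R * nu r in
  let sigma2 : R := \sum_(r < n) (b r)%:R ^+ 2 * nu r in
  let beta : R := mu / sigma2 in
  let lam : R := beta * mu in
  let delta : 'I_n -> R := fun r => (b r)%:R * nu r / mu in
  let alpha : R := alpha_star b beta delta in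
  [/\ ('E_P[S] = mu%:E)%E,
      ('V_P[S] = sigma2%:E)%E &
      1 <= lam ->
      forall (d' : measure_display) (T' : measurableType d')
        (Q : probability T' R) (A_lam : {RV Q >-> nat}),
      poisson_rv A_lam lam ->
      forall y : nat, lam + 1 < y%:R ->
      `| fine (P [set w | y%:R <= beta * S w])
         / fine (Q [set w | (y <= A_lam w)%N]) - 1 |
      <= (1 + alpha) * C_plus y lam + (1 + alpha) * C_minus y lam + alpha].
Proof.
move=> S mu sigma2 beta lam delta alpha.
have ES : ('E_P[S] = mu%:E)%E by exact: compound_poisson_expectation.
split => //; first exact: compound_poisson_variance.
move=> lam1 d' T' Q A_lam A_lam_poisson y lam_y.
have sum_gt0 (F : 'I_n -> R) : (forall r, 0 < F r) -> 0 < \sum_(r < n) F r.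
  move=> F0; rewrite (bigD1 (Ordinal n_ge1))//= ltr_pwDl// sumr_ge0// => r _.
  exact: ltW.
have br_gt0 r : 0 < (b r)%:R :> R by rewrite ltr0n.
have mu_gt0 : 0 < mu by apply: sum_gt0 => r; rewrite mulr_gt0.
have sigma2_gt0 : 0 < sigma2.
  by apply: sum_gt0 => r; rewrite mulr_gt0// exprn_gt0.
have beta_gt0 : 0 < beta by rewrite divr_gt0.
have lam_gt0 : 0 < lam by rewrite mulr_gt0.
have alpha_ge0 : 0 <= alpha.
  by apply: alpha_star_ge0 => r; rewrite divr_ge0 ?ltW// mulr_gt0.
have y_gt0 : 0 < y%:R :> R by apply: lt_trans lam_y; rewrite addr_gt0.
set p := fine _; set q := fine _; set pi := poisson_pmf lam y.-1.
have pi_gt0 : 0 < pi by exact: poisson_pmf_gt0.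
have q_lb : lam / y%:R * pi <= q.
  by apply: poisson_rv_tail_lb => //; rewrite -(ltr0n R).
have q_gt0 : 0 < q by apply: lt_le_trans q_lb; rewrite mulr_gt0// divr_gt0.
have mS : measurable_fun [set: T] S by exact: measurable_compound_poisson.
have p_ub : p <= lam / y%:R.
  have S_ge0 w : 0 <= S w by apply: sumr_ge0 => r _; rewrite mulr_ge0.
  have := ge0_markov P mS S_ge0 (divr_gt0 y_gt0 beta_gt0).
  (* Markov is applied to [S] at level y / beta, so that E[S] = mu yields the bound mu beta / y =
     lam / y. *)
  have -> : [set w | y%:R / beta <= S w] = [set w | y%:R <= beta * S w].
    by apply/funext => w /=; rewrite ler_pdivrMr// mulrC.
  rewrite ES -[P _]fineK ?fin_num_measure//; last first.
    rewrite -[X in measurable X]setTI.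
    exact: (measurable_fun_le measurableT (measurable_cst _)
      (measurable_funM (measurable_cst _) mS)).
  rewrite -EFinM lee_fin -/p => hp.
  by rewrite ler_pdivlMr// -ler_pdivrMl// mulrA mulrAC [_^-1 * _]mulrC// mulrAC.
have p_ge0 : 0 <= p by exact: fine_ge0.
(* As [pi] is a probability, 1 / pi also covers the lower side, where the ratio minus 1 may drop to
   -1. *)
have inv_pi_ge1 : 1 <= pi^-1.
  rewrite invf_ge1// -lee_fin /pi -A_lam_poisson probability_le1//.
  exact: measurable_RV_nat.
(* The factor lam / y common to [p_ub] and [q_lb] cancels. *)
have pq_ub : p / q <= pi^-1.
  rewrite ler_pdivrMr//; apply: le_trans p_ub _.
  by rewrite -ler_pdivrMl ?invr_gt0// invrK mulrC.
have pq_ge0 : 0 <= p / q by rewrite divr_ge0// ltW.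
apply: (@le_trans _ _ (pi^-1)).
  by rewrite ler_norml; apply/andP; split; lra.
have Cm : pi^-1 <= C_minus y lam by exact: invr_poisson_pmf_le_C_minus.
have Cp : 0 <= C_plus y lam by apply: C_plus_ge0; exact: ltW.
have Cm0 : 0 <= C_minus y lam by lra.
(* Once the signs of the two products with [alpha] are supplied, the remaining inequality is
   linear. *)
have := mulr_ge0 alpha_ge0 Cm0; have := mulr_ge0 alpha_ge0 Cp; lra.
Qed.
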